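(* Let $\{S(t): t\ge 0\}$ be an asymptotically closed semigroup on a complete metric space $(V,d)$, $T>0$ and $N\in\mathbb{N}$. Then the following statements are equivalent: (1) There exists a $T$-discrete exponential attractor $\mathbf{M_0}$ in $V$ for the semigroup. (2) There exists a $\frac{T}{N}$-discrete exponential attractor $\mathbf{\widetilde{M}_0}$ in $V$ for the semigroup.
   Context: $\mathbb{N}=\{1,2,\dots\}$, $\mathbb{N}_0=\mathbb{N}\cup\{0\}$. A semigroup $\{S(t):t\ge0\}$ on a metric space $(V,d)$ is a family of maps $S(t):V\to V$ with $S(t)S(s)=S(t+s)$ for $t,s\ge 0$ and $S(0)=I$ the identity; ''$t\ge 0$'' means throughout either $t\in[0,\infty)$ or $t\in\mathbb{N}_0$; the times $T$ and $T/N$ are assumed to belong to the time set. Asymptotically closed: for any $t\ge 0$, $t_k\ge 0$ with $t_k\to\infty$ and any bounded sequence $x_k\in V$, if $S(t_k)x_k\to x$ and $S(t+t_k)x_k\to y$ with $x,y\in V$, then $S(t)x=y$. $\mathrm{dist}^V(G,H)=\sup_{x\in G}\inf_{y\in H}d(x,y)$. $N^V(G,\varepsilon)$ is the minimal number of open $\varepsilon$-balls in $V$ centered at points of $G$ needed to cover $G\subseteq V$. The fractal dimension is $\dim_f^V(G)=\limsup_{\varepsilon\to0^+}\log_{1/\varepsilon}N^V(G,\varepsilon)$. For a time $\tau>0$, a $\tau$-discrete exponential attractor is a nonempty compact set $\mathbf{M}\subseteq V$ such that $S(\tau)\mathbf{M}\subseteq\mathbf{M}$, $\dim_f^V(\mathbf{M})<\infty$,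 and there is $\xi>0$ with $\lim_{t\to\infty}e^{\xi t}\mathrm{dist}^V(S(t)G,\mathbf{M})=0$ for every bounded $G\subseteq V$. *)

(* Defs.v *)
From HB Require Import structures.
From mathcomp Require Import all_boot all_order all_algebra.
From mathcomp Require Import all_classical all_reals all_analysis.

Set Implicit Arguments.
Unset Strict Implicit.
Unset Printing Implicit Defensive.

Import Order.TTheory GRing.Theory Num.Theory.
Import numFieldNormedType.Exports.

Local Open Scope classical_set_scope.
Local Open Scope ring_scope.

Section MetricNotions.
Context {R : realType} {V : metricType R}.
Implicit Types G H : set V.

(* cauchy_cvg of completeType without its base point: V may be empty. *)
Definition complete_space : Prop :=
  forall F : set_system V, ProperFilter F -> cauchy F -> exists x : V, F --> x.

Definition metric_bounded G : Prop :=
  exists r : R, forall x y, G x -> G y -> mdist x y <= r.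

(* The maximum with 0 only matters for G = set0, where the supremum is meant
   in [0, +oo] whereas ereal_sup set0 = -oo. *)
Definition semidist G H : \bar R :=
  maxe 0%E (ereal_sup [set ereal_inf [set (mdist x y)%:E | y in H] | x in G]).

(* +oo if no finite cover exists. *)
Definition covering_number G (eps : R) : \bar R :=
  ereal_inf [set (n%:R)%:E | n in [set n : nat | exists c : 'I_n -> V,
    (forall i, G (c i)) /\ G `<=` \bigcup_i ball (c i) eps]].

Definition fractal_dim G : \bar R :=
  limf_esup (fun eps : R =>
    (lne (covering_number G eps) * ((ln eps^-1)^-1)%:E)%E) (0 : R)^'+.

End MetricNotions.

Arguments complete_space {R} V.

Variant time_kind := continuous_time | discrete_time.

Definition times {R : realType} (k : time_kind) : set R :=
  match k with
  | continuous_time => [set t | 0 <= t]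
  | discrete_time => range (fun n : nat => n%:R)
  end.

(* The maps S t are relevant only for t in the time set. *)
Section Semigroups.
Context {R : realType} {V : metricType R}.
Variables (k : time_kind) (S : R -> V -> V).

Definition semigroup : Prop :=
  (forall x, S 0 x = x) /\
  (forall t s x, times k t -> times k s -> S t (S s x) = S (t + s) x).

Definition asymptotically_closed : Prop :=
  forall (t : R) (t_ : R^nat) (x_ : nat -> V) (x y : V),
    times k t -> (forall n, times k (t_ n)) ->
    t_ n @[n --> \oo] --> +oo ->
    metric_bounded (range x_) ->
    S (t_ n) (x_ n) @[n --> \oo] --> x ->
    S (t + t_ n) (x_ n) @[n --> \oo] --> y ->
    S t x = y.

Definition discrete_exp_attractor (tau : R) (M : set V) : Prop :=
  [/\ M !=set0,
      compact M,
      S tau @` M `<=` M,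
      (fractal_dim M < +oo)%E &
      exists2 xi : R, 0 < xi & forall G : set V, metric_bounded G ->
        ((expR (xi * t))%:E * semidist (S t @` G) M)%E
          @[t --> within (times k) +oo] --> 0%E].

End Semigroups.

(* Main.v *)
Require Import Defs.
From HB Require Import structures.
From mathcomp Require Import all_boot all_order all_algebra.
From mathcomp Require Import all_classical all_reals all_analysis.
From mathcomp Require Import zify lra.

Set Implicit Arguments.
Unset Strict Implicit.
Unset Printing Implicit Defensive.

Import Order.TTheory GRing.Theory Num.Theory.
Import numFieldNormedType.Exports.

Local Open Scope classical_set_scope.
Local Open Scope ring_scope.

(** Only the attraction property, the compactness and the dimension of the given
    attractor [M0] matter, so an attractor can be built for an arbitrary time
    [tau > 0].  Since [S tau] need not be continuous, the union of the sets
    [S (j * tau) M0] is useless.  Instead let [f := S tau], let [B0] be the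
    1-neighbourhood of [M0], which absorbs every bounded set, and let [A] be the
    omega-limit set of [B0] under [f].  It is a subset of [M0], and [f] maps it
    to itself because the semigroup is asymptotically closed.  As [f^n B0] lies
    within [rho^n] of [M0], it has a net of mesh [4 rho^n] with [K^n] points;
    adding to [A] the forward orbits of all these nets gives the new attractor.
    It has finite dimension because, for each [p], all of it except at most
    [p^2 K^p] points lies within [rho^p] of [M0]. *)

(** * Coverings by balls, neighbourhoods, and filters approaching a compact set *)

Section Coverings.
Context {R : realType} {V : metricType R}.
Implicit Types (G H : set V) (m : nat) (r : R).

(** Unlike in [covering_number], the centres may lie anywhere in the space, which lets the notion
    pass to subsets. *)
Definition covered m r G : Prop :=
  exists c : 'I_m -> V, G `<=` \bigcup_i ball (c i) r.

Lemma coveredS m r G H : H `<=` G -> covered m r G -> covered m r H.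
Proof. by move=> HG [c Gc]; exists c; exact: subset_trans Gc. Qed.

Lemma covered_set0 m r (x : V) : covered m r set0.
Proof. by exists (fun=> x). Qed.

Lemma covered_le m m' r (x : V) G :
  (m <= m')%N -> covered m r G -> covered m' r G.
Proof.
(* The point [x] serves as centre for the surplus indices. *)
move=> le_m [c Gc]; exists (fun i => oapp c x (insub (val i))) => y /Gc [i _ yi].
exists (widen_ord le_m i) => //=; rewrite insubT //= => im.
by rewrite (_ : Sub _ _ = i) //; exact: val_inj.
Qed.

Lemma coveredU m m' r G H :
  covered m r G -> covered m' r H -> covered (m + m') r (G `|` H).
Proof.
move=> [c Gc] [c' Hc'].
exists (fun i => match fintype.split i with inl j => c j | inr j => c' j end).
move=> y [/Gc|/Hc'] [i _ yi].
- exists (lshift m' i) => //; case: split_ordP => j; first by move=> /lshift_inj <-.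
  by move=> /eqP; rewrite eq_lrshift.
- exists (rshift m i) => //; case: split_ordP => j; last by move=> /rshift_inj <-.
  by move=> /eqP; rewrite eq_rlshift.
Qed.

Lemma covered_bigcup (x : V) m r p (G : nat -> set V) :
  (forall n, (n < p)%N -> covered m r (G n)) ->
  covered (p * m) r (\bigcup_(n in [set n | (n < p)%N]) G n).
Proof.
elim: p => [|p IHp] Gm.
  by apply: coveredS (covered_set0 _ _ x) => y [n].
rewrite mulSn; apply: coveredS (coveredU (Gm p _) (IHp _)); last 2 first.
- exact: ltnSn.
- by move=> n np; apply: Gm; exact: ltnW.
move=> y [n /=]; rewrite ltnS leq_eqVlt => /orP[/eqP ->|np] yn; first by left.
by right; exists n.
Qed.

(** A ball that meets [G] lies in the ball of twice the radius about any point of [G] in it; a ball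
    that misses [G] gets an arbitrary centre in [G]. *)
Lemma covered_recenter m r G : G !=set0 -> covered m r G ->
  exists2 c : 'I_m -> V, forall i, G (c i) &
    G `<=` \bigcup_i ball (c i) (r + r).
Proof.
move=> [x Gx] [c Gc].
have /choice[c' c'P] : forall i, exists y, G y /\
    (forall z, G z -> ball (c i) r z -> ball y (r + r) z).
  move=> i; have [[y [Gy iy]]|no] := pselect (exists y, G y /\ ball (c i) r y).
    exists y; split => // z _ iz.
    by apply: ball_triangle iz; exact: ball_sym.
  by exists x; split => // z Gz iz; exfalso; apply: no; exists z.
exists c' => [i|y Gy]; first by have [] := c'P i.
by have [i _ iy] := Gc y Gy; exists i => //; have [_] := c'P i; exact.
Qed.

Definition within_nbhd r H : set V := [set x | exists2 y, H y & ball y r x].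

Lemma covered_within_nbhd m r r' H :
  covered m r H -> covered m (r + r') (within_nbhd r' H).
Proof.
move=> [c Hc]; exists c => x [y /Hc[i _ iy] yx].
by exists i => //; exact: ball_triangle yx.
Qed.

Lemma covered_bounded m r G : covered m r G -> metric_bounded G.
Proof.
move=> [c Gc].
pose b := \sum_(i < m) \sum_(j < m) mdist (c i) (c j).
exists (r + r + b) => x y /Gc[i _ ix] /Gc[j _ jy].
have ij : mdist (c i) (c j) <= b.
  rewrite /b (bigD1 i) //= (bigD1 j) //= -addrA lerDl addr_ge0 //.
    by apply: sumr_ge0 => k _; exact: mdist_ge0.
  by apply: sumr_ge0 => k _; apply: sumr_ge0 => l _; exact: mdist_ge0.
move: ix jy; rewrite !ballEmdist /= => ix jy.
have := metric_triangle x (c i) y; have := metric_triangle (c i) (c j) y.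
rewrite (metric_sym x (c i)); lra.
Qed.

Lemma metric_bounded_within_nbhd r H :
  metric_bounded H -> metric_bounded (within_nbhd r H).
Proof.
move=> [b Hb]; exists (r + r + b) => x x' [y Hy yx] [y' Hy' y'x'].
move: yx y'x'; rewrite !ballEmdist /= => yx y'x'.
have := metric_triangle x y x'; have := metric_triangle y y' x'.
have := Hb _ _ Hy Hy'; rewrite (metric_sym x y); lra.
Qed.

(** The filter is moved into [M]: the points of [M] within [e] of [P], for [P] in [F] and [e > 0],
    form a filter base on [M], and by the triangle inequality its cluster points are cluster points
    of [F]. *)
Lemma compact_cluster_near (M : set V) (F : set_system V) :
  ProperFilter F -> compact M ->
  (forall e, 0 < e -> F (within_nbhd e M)) -> exists2 p, M p & cluster F p.
Proof.
move=> PF cM FM.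
pose B (Pe : set V * R) : set V :=
  [set y | M y /\ exists2 x, Pe.1 x & ball y Pe.2 x].
pose D : set (set V * R) := [set Pe | F Pe.1 /\ 0 < Pe.2].
have FB : ProperFilter (filter_from D B).
  apply: filter_from_proper; last first.
    move=> [P e] [/= FP e0].
    have [x [Px [y My yx]]] := filter_ex (filterI FP (FM _ e0)).
    by exists y; split => //; exists x.
  apply: filter_from_filter; first by exists (setT, 1); split; [exact: filterT|].
  move=> [P e] [Q d] [/= FP e0] [/= FQ d0]; exists (P `&` Q, Order.min e d).
    by split => /=; [exact: filterI|rewrite lt_min e0].
  move=> y [/= My [x [Px Qx] yx]]; split; split => //; exists x => //=;
    by apply: le_ball yx; rewrite ge_min lexx ?orbT.
have [|p [Mp clp]] := cM _ FB.
  by exists (setT, 1) => [|y [] //]; split => //=; exact: filterT.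
exists p => // P Q FP /nbhs_ballP[e /= e0 eQ].
have e20 : 0 < e / 2 by rewrite divr_gt0.
have [|y [[_ [x Px yx]] py]] := clp (B (P, e / 2)) _ _ (nbhsx_ballx p _ e20).
  by exists (P, e / 2).
by exists x; split => //; apply: eQ; rewrite (splitr e); exact: ball_triangle yx.
Qed.

End Coverings.

Lemma exprn_lt_eventually (R : realType) (rho e : R) : 0 < rho < 1 -> 0 < e ->
  exists p, forall n, (p <= n)%N -> rho ^+ n < e.
Proof.
move=> /andP[rho0 rho1] e0.
have /cvgrPdist_lt /(_ e e0) [p _ pP] : rho ^+ n @[n --> \oo] --> (0 : R).
  by apply: cvg_expr; rewrite gtr0_norm.
exists p => n /pP /=; rewrite sub0r normrN ger0_norm //.
by rewrite exprn_ge0 // ltW.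
Qed.

(** * The attractor of a single map [f], later taken to be [S tau] *)

Section DiscreteAttractor.
Context {R : realType} {V : metricType R}.
Variables (f : V -> V) (M0 B0 : set V) (rho : R) (K n0 : nat).
Hypothesis rho01 : 0 < rho < 1.
Hypothesis K_gt0 : (0 < K)%N.
Hypothesis cM0 : compact M0.
Hypothesis B0_neq0 : B0 !=set0.
Hypothesis M0_covered : forall n, (n0 <= n)%N -> covered (K ^ n) (rho ^+ n) M0.
Hypothesis M0_attracts : forall n, (n0 <= n)%N ->
  iter n f @` B0 `<=` within_nbhd (rho ^+ n) M0.
Hypothesis f_closed : forall (n_ : nat -> nat) (x_ : nat -> V) x y,
  (forall k, (k <= n_ k)%N) -> (forall k, B0 (x_ k)) ->
  iter (n_ k) f (x_ k) @[k --> \oo] --> x ->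
  iter (n_ k).+1 f (x_ k) @[k --> \oo] --> y -> f x = y.

Let tail p : set V :=
  [set x | exists n b, [/\ (p <= n)%N, B0 b & x = iter n f b]].

Let A : set V := \bigcap_p closure (tail p).

Let rho_gt0 : 0 < rho. Proof. by case/andP: rho01. Qed.

Let tail_near p : (n0 <= p)%N -> tail p `<=` within_nbhd (rho ^+ p) M0.
Proof.
move=> n0p x [n [b [pn Bb ->]]].
have [|y My yx] := M0_attracts (leq_trans n0p pn) (t := iter n f b).
  by exists b.
exists y => //; apply: le_ball yx.
by case/andP: rho01 => r0 r1; apply: ler_wiXn2l => //; exact: ltW.
Qed.

Let AP x : A x <-> forall p e, 0 < e -> exists2 z, tail p z & ball x e z.
Proof.
split => [Ax p e e0|Ax p _ P /nbhs_ballP[e /= e0 eP]].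
  by have [z [pz xz]] := Ax p I _ (nbhsx_ballx x e e0); exists z.
by have [z pz xz] := Ax p e e0; exists z; split => //; exact: eP.
Qed.

(** Points of [A] are limits of points of arbitrarily late tails, which come arbitrarily close to
    [M0], and [M0] is closed. *)
Let A_sub_M0 : A `<=` M0.
Proof.
move=> x /AP Ax; apply: (compact_closed (@metric_hausdorff _ V) cM0).
move=> P /nbhs_ballP[e /= e0 eP].
have e20 : 0 < e / 2 by rewrite divr_gt0.
have [p pP] := exprn_lt_eventually rho01 e20.
have [z pz xz] := Ax (maxn p n0) _ e20.
have [y My yz] := tail_near (leq_maxr p n0) pz.
exists y; split => //; apply: eP; rewrite (splitr e).
apply: ball_triangle xz _; apply: ball_sym; apply: le_ball yz.
by apply/ltW/pP; exact: leq_maxl.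
Qed.

Let A_near p x : A x -> within_nbhd (rho ^+ p) M0 x.
Proof.
move=> /A_sub_M0 Mx; exists x => //; apply: ballxx; exact: exprn_gt0.
Qed.

Let cvg_inv_ball (z : nat -> V) x :
  (forall k, ball x k.+1%:R^-1 (z k)) -> z k @[k --> \oo] --> x.
Proof.
move=> zx; apply/cvg_ballP => e e0.
have [k _ ke] := near_infty_natSinv_lt (PosNum e0).
by exists k => // n /= kn; apply: le_ball (zx n); exact/ltW/ke.
Qed.

(** A point [x] of [A] is a limit of iterates [iter n_k f b_k] with [n_k >= k]. The next iterates
    approach the compact [M0], so they cluster at some [y]; [f_closed] along a subsequence gives
    [f x = y], and [y] is in [A] as a limit of late iterates. *)
Let f_A : f @` A `<=` A.
Proof.
move=> _ [x /AP Ax <-].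
have /choice[nb nbP] : forall k : nat, exists nb : nat * V,
    [/\ (k <= nb.1)%N, B0 nb.2 & ball x k.+1%:R^-1 (iter nb.1 f nb.2)].
  move=> k; have [|_ [n [b [kn Bb ->]]] xz] := Ax k k.+1%:R^-1.
    by rewrite invr_gt0.
  by exists (n, b).
pose z k := iter (nb k).1.+1 f (nb k).2.
have z_tail p k : (p <= k)%N -> tail p (z k).
  have [kn Bb _] := nbP k; move=> pk; exists (nb k).1.+1, (nb k).2; split => //.
  by rewrite (leq_trans pk) // ltnW.
have [e e0|y My cly] := compact_cluster_near (F := z @ \oo) _ cM0.
  have [p pP] := exprn_lt_eventually rho01 e0.
  exists (maxn p n0) => // k /= /z_tail /(tail_near (leq_maxr _ _)) [w Mw wz].
  by exists w => //; apply: le_ball wz; apply/ltW/pP; exact: leq_maxl.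
(* The choice [j >= k] keeps the rate [1 / (k + 1)] towards [x] and makes the iterates arbitrarily
   late. *)
have /choice[phi phiP] : forall k : nat, exists j : nat,
    (k <= j)%N /\ ball y k.+1%:R^-1 (z j).
  move=> k; have [||_ [[j kj <-] yz]] :=
      cly [set z j | j in [set j | (k <= j)%N]] (ball y k.+1%:R^-1).
  - by exists k => // j /= kj; exists j.
  - by apply: nbhsx_ballx; rewrite invr_gt0.
  - by exists j.
suff -> : f x = y.
  apply/AP => p e e0.
  have [k _ ke] := near_infty_natSinv_lt (PosNum e0).
  have [kj yj] := phiP (maxn k p).
  exists (z (phi (maxn k p))).
    by apply: z_tail; rewrite (leq_trans _ kj) // leq_maxr.
  by apply: le_ball yj; apply/ltW/ke; exact: leq_maxl.
apply: (f_closed (n_ := fun k => (nb (phi k)).1) (x_ := fun k => (nb (phi k)).2)).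
- move=> k; have [kn _ _] := nbP (phi k); have [kj _] := phiP k.
  exact: leq_trans kn.
- by move=> k; have [] := nbP (phi k).
- apply: cvg_inv_ball => k; have [_ _] := nbP (phi k); apply: le_ball.
  by rewrite lef_pV2 ?posrE // ler_nat ltnS; have [] := phiP k.
- by apply: cvg_inv_ball => k; have [] := phiP k.
Qed.

(** [M0] is covered at radius [rho ^+ n], its neighbourhood at twice that, and moving the centres
    into the iterate of [B0] doubles once more. The premise [n0 <= n] sits under the existential so
    that [u] is defined for every [n]; below [n0] it is a dummy that [orbits] excludes. *)
Let net n : exists c : 'I_(K ^ n) -> V, (n0 <= n)%N ->
  (forall i, (iter n f @` B0) (c i)) /\
  iter n f @` B0 `<=` \bigcup_i ball (c i) (4 * rho ^+ n).
Proof.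
have [n0n|] := leqP n0 n; last by have [b _] := B0_neq0; exists (fun=> b).
have [||c cB Bc] := @covered_recenter _ _ (K ^ n) (rho ^+ n + rho ^+ n)
    (iter n f @` B0).
- by have [b Bb] := B0_neq0; exists (iter n f b); exists b.
- apply: coveredS (M0_attracts n0n) _.
  exact/covered_within_nbhd/M0_covered.
- exists c => _; split => //.
  by rewrite (_ : 4 * _ = rho ^+ n + rho ^+ n + (rho ^+ n + rho ^+ n)) //; lra.
Qed.

Let u n : 'I_(K ^ n) -> V := sval (cid (net n)).

Let uB n (i : 'I_(K ^ n)) : (n0 <= n)%N -> (iter n f @` B0) (u i).
Proof. by move=> n0n; have [cB _] := svalP (cid (net n)) n0n; exact: cB. Qed.

Let Bu n : (n0 <= n)%N ->
  iter n f @` B0 `<=` \bigcup_i ball (u (n := n) i) (4 * rho ^+ n).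
Proof. by move=> n0n; have [_ Bc] := svalP (cid (net n)) n0n; exact: Bc. Qed.

Let orbits n m : set V :=
  [set x | (n0 <= n)%N /\ exists i, x = iter m f (u (n := n) i)].

Let initial p : set V := \bigcup_(n in [set n | (n < p)%N])
  \bigcup_(m in [set m | (m < p)%N]) orbits n m.

Let M : set V := A `|` \bigcup_n \bigcup_m orbits n m.

Let orbits_tail n m : orbits n m `<=` tail (n + m).
Proof.
move=> _ [n0n [i ->]]; have [b Bb <-] := uB i n0n.
by exists (m + n)%N, b; split => //; [rewrite addnC|rewrite iterD].
Qed.

(** A point of [orbits n m] lies in [tail (n + m)], hence in [tail p] unless both indices are below
    [p]. *)
Let M_split p x : M x -> [\/ initial p x, A x | tail p x].
Proof.
move=> [|[n _ [m _ xE]]]; first by constructor 2.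
have [np|pn] := ltnP n p; last first.
  constructor 3; have [k [b [kE Bb ->]]] := orbits_tail xE.
  by exists k, b; split => //; apply: leq_trans kE; rewrite (leq_trans pn) ?leq_addr.
have [mp|pm] := ltnP m p; first by constructor 1; exists n => //; exists m.
constructor 3; have [k [b [kE Bb ->]]] := orbits_tail xE.
by exists k, b; split => //; apply: leq_trans kE; rewrite (leq_trans pm) ?leq_addl.
Qed.

Let initial_sub_M p : initial p `<=` M.
Proof. by move=> x [n _ [m _ xE]]; right; exists n => //; exists m. Qed.

Let M_near p x : (n0 <= p)%N -> M x -> initial p x \/ within_nbhd (rho ^+ p) M0 x.
Proof.
move=> n0p /(M_split p) [|Ax|px]; [by left|right|right].
  exact: A_near.
exact: tail_near.
Qed.

(** An ultrafilter on [M] either contains one of the finite sets [initial p] or avoids all of them.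
    In the second case it approaches [M0], so it has a cluster point, which is a limit; for every
    [p], each neighbourhood of that point meets [A] or [tail p], so the point belongs to [A]. *)
Let cM : compact M.
Proof.
rewrite compact_ultra => F UF FM.
have [[p Fp]|noF] := pselect (exists p, F (initial p)).
  have : finite_set (initial p).
    apply: bigcup_finite; first exact: finite_II.
    move=> n _; apply: bigcup_finite; first exact: finite_II.
    move=> m _; have : finite_set [set: 'I_(K ^ n)] by exact: finite_finset.
    move/(finite_image (fun i => iter m f (u i))); apply: sub_finite_set.
    by move=> _ [_ [i ->]]; exists i.
  move=> /finite_compact; rewrite compact_ultra => /(_ F UF Fp) [x [px Fx]].
  by exists x; split => //; exact: initial_sub_M px.
have FN p : F (~` initial p).
  by have [Fp|//] := in_ultra_setVsetC (initial p) UF; case: noF; exists p.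
have [e e0|x Mx clx] := compact_cluster_near (F := F) _ cM0.
  have [p pP] := exprn_lt_eventually rho01 e0.
  apply: filterS (filterI FM (FN (maxn p n0))) => x [Mx nx].
  have [//|[y My yx]] := M_near (leq_maxr p n0) Mx.
  by exists y => //; apply: le_ball yx; apply/ltW/pP; exact: leq_maxl.
exists x; split; last by rewrite -(ultra_cvg_clusterE UF).
left; apply/AP => p e e0; have e20 : 0 < e / 2 by rewrite divr_gt0.
have [z [[Mz nz] xz]] := clx _ _ (filterI FM (FN p)) (nbhsx_ballx x _ e20).
have [//|/AP/(_ p _ e20)[w pw zw]|pz] := M_split p Mz.
  by exists w => //; rewrite (splitr e); exact: ball_triangle zw.
by exists z => //; apply: le_ball xz; lra.
Qed.

Let f_M : f @` M `<=` M.
Proof.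
move=> _ [x [Ax|[n _ [m _ [n0n [i ->]]]]] <-]; first by left; apply: f_A; exists x.
by right; exists n => //; exists m.+1 => //; split => //; exists i.
Qed.

Let M_neq0 : M !=set0.
Proof.
have i : 'I_(K ^ n0) by exists 0; rewrite expn_gt0 K_gt0.
by exists (u i); right; exists n0 => //; exists 0 => //; split => //; exists i.
Qed.

(** The set [initial p] takes [p * p] coverings by [K ^ p] balls and the rest takes one more;
    [p < 2 ^ p] gives [p ^ 2 + 1 <= 4 ^ p] for the count. The radius is [2 * rho ^+ p] before
    recentring. *)
Let M_covered p : (n0 <= p)%N -> exists2 c : 'I_((4 * K) ^ p) -> V,
  forall i, M (c i) & M `<=` \bigcup_i ball (c i) (4 * rho ^+ p).
Proof.
move=> n0p; have rp : 0 < rho ^+ p by exact: exprn_gt0.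
have [x Mx] := M_neq0.
rewrite (_ : 4 * rho ^+ p = (rho ^+ p + rho ^+ p) + (rho ^+ p + rho ^+ p)); last by lra.
apply: covered_recenter => //.
apply: (@covered_le _ _ (p * (p * K ^ p) + K ^ p) _ _ x).
  rewrite mulnA -mulSnr expnMn leq_mul2r; apply/orP; right.
  have pp := ltn_expl p (ltnSn 1).
  rewrite (_ : 4 = 2 * 2)%N // expnMn; apply: leq_trans (leq_mul pp pp); nia.
have MU : M `<=` initial p `|` within_nbhd (rho ^+ p) M0.
  by move=> y /(M_near n0p) [|]; [left|right].
apply: coveredS MU _; apply: coveredU; last first.
  exact/covered_within_nbhd/M0_covered.
apply: (covered_bigcup x) => n np; apply: (covered_bigcup x) => m mp.
have pK : (K ^ n <= K ^ p)%N by rewrite leq_pexp2l // ltnW.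
apply: (covered_le x pK); exists (fun i => iter m f (u i)) => _ [_ [i ->]].
by exists i => //; apply: ballxx; lra.
Qed.

Lemma discrete_attractor : exists M : set V,
  [/\ M !=set0, compact M, f @` M `<=` M,
    forall p, (n0 <= p)%N -> exists2 c : 'I_((4 * K) ^ p) -> V,
      forall i, M (c i) & M `<=` \bigcup_i ball (c i) (4 * rho ^+ p) &
    forall n, (n0 <= n)%N -> iter n f @` B0 `<=` within_nbhd (4 * rho ^+ n) M].
Proof.
exists M; split => // n n0n x /(Bu n0n) [i _ ix]; exists (u i) => //.
by right; exists n => //; exists 0 => //; split => //; exists i.
Qed.

End DiscreteAttractor.

(** * Finite fractal dimension and geometric sequences of coverings *)

Section FractalDimension.
Context {R : realType} {V : metricType R}.
Implicit Types (M : set V) (rho C : R) (K : nat).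

Lemma covering_number_ge0 M (e : R) : (0 <= covering_number M e)%E.
Proof. by apply: le_ereal_inf_tmp => _ [n _ <-]; rewrite lee_fin. Qed.

(** For small [e] the covering number is at most [1 / e] to the power [d]; at [e = rho ^+ n] this is
    the n-th power of a constant. *)
Lemma fractal_dim_covered M rho : 0 < rho < 1 -> M !=set0 ->
  (fractal_dim M < +oo)%E ->
  exists K n0, (0 < K)%N /\
    forall n, (n0 <= n)%N -> covered (K ^ n) (rho ^+ n) M.
Proof.
move=> rho01 [x Mx] /ereal_inf_lt[_ [A A0 <-] sA].
have [d Ad] : exists d : R, forall e, A e ->
    (lne (covering_number M e) * ((ln e^-1)^-1)%:E <= d%:E)%E.
  have [d sd] : exists d : R, (ereal_sup [set (lne (covering_number M e) *
      ((ln e^-1)^-1)%:E)%E | e in A] <= d%:E)%E.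
    case: (ereal_sup _) sA => [d| |] // _; first by exists d.
    by exists 0; rewrite leNye.
  by exists d => e Ae; apply: le_trans sd; apply: ereal_sup_ubound; exists e.
have [e /= e0 eA] : exists2 e, 0 < e & forall z : R, 0 < z -> z < e -> A z.
  case: A0 => e /= e0 eA; exists e => // z z0 ze; apply: eA => //=.
  by rewrite sub0r normrN gtr0_norm.
have [p pP] := exprn_lt_eventually rho01 e0.
have /andP[rho0 _] := rho01.
pose lam := - ln rho; have lam0 : 0 < lam by rewrite oppr_gt0 ln_lt0.
(* The integer [K] exceeds [expR (d * lam)], which is [rho] to the power [- d]; starting at [p.+1]
   keeps [n] positive. *)
pose K := (Num.truncn (expR (d * lam))).+1; exists K, p.+1; split => // n pn.
have n0 : 0 < n%:R :> R by rewrite ltr0n (leq_trans _ pn).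
have rn0 : 0 < rho ^+ n by exact: exprn_gt0.
have K0 : 0 < K%:R :> R by rewrite ltr0n.
have dK : d * lam < ln K%:R.
  by rewrite -ltr_expR lnK ?posrE // truncnS_gt.
(* Strictness extracts an actual finite cover from the infimum. *)
have NK : (covering_number M (rho ^+ n) < ((K ^ n)%:R)%:E)%E.
  rewrite ltNge; apply/negP => KN.
  have := Ad _ (eA _ rn0 (pP _ (ltnW pn))); apply/negP; rewrite -ltNge.
  have lnE : ln (rho ^+ n)^-1 = n%:R * lam.
    by rewrite lnV ?posrE // lnXn // -mulNrn mulr_natl.
  rewrite lnE lte_pdivlMr ?mulr_gt0 // -EFinM.
  apply: (@lt_le_trans _ _ (lne ((K ^ n)%:R)%:E)).
    rewrite lne_EFin ?ltr0n ?expn_gt0 // lte_fin natrX lnXn // -[ltRHS]mulr_natl.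
    by rewrite mulrCA ltr_pM2l.
  by rewrite lee_lne // in_itv /= leey andbT ?lee_fin // covering_number_ge0.
have [_ [m [c [_ Mc]] <-]] := ereal_inf_lt NK.
rewrite lte_fin ltr_nat => mK; apply: (covered_le x (ltnW mK)).
by exists c.
Qed.

(** For small [e] some [p] satisfies [C * rho ^+ p <= e] and is bounded by a multiple of
    [ln (1 / e)], while the logarithm of the covering number at [e] is at most [p * ln K]. *)
Lemma covered_fractal_dim M rho C K n0 : 0 < rho < 1 -> 0 < C -> (0 < K)%N ->
  (forall p, (n0 <= p)%N -> exists2 c : 'I_(K ^ p) -> V,
     forall i, M (c i) & M `<=` \bigcup_i ball (c i) (C * rho ^+ p)) ->
  (fractal_dim M < +oo)%E.
Proof.
move=> rho01 C0 K0 Mc; have /andP[rho0 _] := rho01.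
pose lam := - ln rho; have lam0 : 0 < lam by rewrite oppr_gt0 ln_lt0.
have lnK0 : 0 <= ln K%:R :> R by rewrite ln_ge0 // ler1n.
(* For [l = ln (1 / e) > L] this yields [l >= 1], [q >= 0] and [p >= n0] below. *)
pose L := 1 + `|ln C| + n0%:R * lam.
have L1 : 1 <= L by rewrite /L -addrA lerDl addr_ge0 // mulr_ge0 // ltW.
(* Chosen so that [(q + 1) * ln K <= d * l], by [q * lam = ln C + l] and [l >= 1]. *)
pose d := ((`|ln C| + 1) / lam + 1) * ln K%:R.
apply: (@le_lt_trans _ _ d%:E); last exact: ltry.
apply: ge_ereal_inf; eexists.
  exists [set e | 0 < e < expR (- L)] => //.
  exists (expR (- L)) => /=; first exact: expR_gt0.
  by move=> z /=; rewrite sub0r normrN => + z0; rewrite gtr0_norm ?z0.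
apply: ge_ereal_sup => _ [e /= /andP[e0 eL] <-].
have lneL : L < ln e^-1.
  by rewrite lnV ?posrE // ltrNr -ltr_expR lnK.
set l := ln e^-1 in lneL *.
have l0 : 0 < l by rewrite (lt_trans _ lneL) // (lt_le_trans _ L1).
have lC : - `|ln C| <= ln C by rewrite lerNl -normrN ler_norm.
have lC' : ln C <= `|ln C| by exact: ler_norm.
have nlam : 0 <= n0%:R * lam by rewrite mulr_ge0 // ltW.
(* Here [q] is the real exponent at which [C] times that power of [rho] equals [e]; the next larger
   integer is [p]. *)
have [q q0 qE] : exists2 q, 0 <= q & q * lam = ln C + l.
  exists ((ln C + l) / lam); last by rewrite divfK // gt_eqF.
  rewrite divr_ge0 ?(ltW lam0) //; move: lneL; rewrite /L; lra.
have /andP[pq qp] := truncn_itv q0; set p := (Num.truncn q).+1 in qp.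
have n0p : (n0 <= p)%N.
  rewrite -(ler_nat R) (le_trans _ (ltW qp)) // -(ler_pM2r lam0) qE.
  by move: lneL; rewrite /L; lra.
have Crho : C * rho ^+ p <= e.
  rewrite -ler_ln ?posrE ?mulr_gt0 ?exprn_gt0 // lnM ?posrE ?exprn_gt0 //.
  rewrite lnXn // (_ : ln e = - l); last by rewrite /l lnV ?posrE // opprK.
  have : q * lam < p%:R * lam by rewrite ltr_pM2r.
  by rewrite qE /lam mulrN mulr_natl; lra.
have [c cM Mc'] := Mc p n0p.
have cov : (covering_number M e <= ((K ^ p)%:R)%:E)%E.
  apply: ereal_inf_lbound; exists (K ^ p)%N => //=; exists c; split => //.
  by move=> y /Mc'[i _ iy]; exists i => //; exact: le_ball iy.
rewrite lee_pdivrMr // -EFinM.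
apply: (@le_trans _ _ (lne ((K ^ p)%:R)%:E)).
  by rewrite lee_lne // in_itv /= leey andbT ?lee_fin // covering_number_ge0.
rewrite lne_EFin ?ltr0n ?expn_gt0 ?K0 // lee_fin natrX lnXn ?ltr0n //.
rewrite -[leLHS]mulr_natl /d mulrAC ler_wpM2r //.
have -> : p%:R = (Num.truncn q)%:R + 1 :> R by rewrite -natr1.
have l1 : 1 <= l by exact: ltW (le_lt_trans L1 lneL).
have ql : q <= (`|ln C| + 1) / lam * l.
  rewrite -(ler_pM2r lam0) qE mulrAC divfK ?gt_eqF //.
  have : `|ln C| <= `|ln C| * l by rewrite ler_peMr.
  lra.
rewrite mulrDl mul1r; lra.
Qed.

End FractalDimension.

(** * Attraction under the semigroup and the change of the time step *)

Section ExponentialAttractors.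
Context {R : realType} {V : metricType R}.
Variables (k : time_kind) (S : R -> V -> V).
Implicit Types (G H M : set V) (t tau xi : R).

Lemma semidist_within_nbhd r G H :
  (semidist G H < r%:E)%E -> G `<=` within_nbhd r H.
Proof.
rewrite /semidist gt_max => /andP[_ GH] x Gx.
have /ereal_inf_lt[_ [y Hy <-]] :
    (ereal_inf [set (mdist x y)%:E | y in H] < r%:E)%E.
  by apply: le_lt_trans GH; apply: ereal_sup_ubound; exists x.
by rewrite lte_fin metric_sym => xy; exists y => //; rewrite ballEmdist.
Qed.

Lemma within_nbhd_semidist r G H : 0 <= r ->
  G `<=` within_nbhd r H -> (semidist G H <= r%:E)%E.
Proof.
move=> r0 GH; rewrite /semidist ge_max lee_fin r0 /=.
apply: ge_ereal_sup => _ [x /GH[y Hy yx] <-].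
apply: ge_ereal_inf; exists (mdist x y)%:E; first by exists y.
by move: yx; rewrite ballEmdist /= metric_sym lee_fin => /ltW.
Qed.

Lemma times_ge0 t : times k t -> 0 <= t.
Proof. by case: k => //= -[n _ <-]. Qed.

Lemma timesMn n t : times k t -> times k (n%:R * t).
Proof.
case: k => /= [|[m _ <-]]; first exact: mulr_ge0.
by exists (n * m)%N => //; rewrite natrM.
Qed.

Lemma timesB t s : times k t -> times k s -> s <= t -> times k (t - s).
Proof.
case: k => /= [_ _ st|[n _ <-] [m _ <-]]; first by rewrite subr_ge0.
by rewrite ler_nat => mn; exists (n - m)%N => //; rewrite natrB.
Qed.

Lemma semigroup_iter tau n x : semigroup k S -> times k tau ->
  iter n (S tau) x = S (n%:R * tau) x.
Proof.
move=> [S0 SD] ktau; elim: n => [|n IHn]; first by rewrite mul0r S0.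
rewrite iterS IHn SD //; last exact: timesMn.
by rewrite -(natr1 n) mulrDl mul1r addrC.
Qed.

(** Eventually the product is below 1, and dividing by the exponential leaves the radius. *)
Lemma attracted_within_nbhd xi G M :
  ((expR (xi * t))%:E * semidist (S t @` G) M)%E
    @[t --> within (times k) +oo] --> 0%E ->
  exists2 t0, 0 <= t0 & forall t, times k t -> t0 <= t ->
    S t @` G `<=` within_nbhd (expR (- (xi * t))) M.
Proof.
move=> /(_ [set y | y < 1%:E]%E) [].
  by apply: open_nbhs_nbhs; split; [exact: open_ereal_lt_ereal|exact: lte01].
move=> t0 [_ tP]; exists (`|t0| + 1); first exact: addr_ge0.
move=> t kt t0t; apply: semidist_within_nbhd.
have : t0 < t by have := ler_norm t0; lra.
move=> /tP /(_ kt) /=.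
by rewrite expRN -[X in (X%:E * _)%E]invrK lte_pdivrMl ?invr_gt0 ?expR_gt0 // mule1.
Qed.

(** A multiple of [expR (- (xi * t))] only stays bounded when multiplied by [expR (xi * t)]; at the
    rate [xi / 2] the product tends to 0. *)
Lemma within_nbhd_attracted xi C t0 G M : 0 < xi -> 0 <= C ->
  (forall t, times k t -> t0 <= t ->
     S t @` G `<=` within_nbhd (C * expR (- (xi * t))) M) ->
  ((expR (xi / 2 * t))%:E * semidist (S t @` G) M)%E
    @[t --> within (times k) +oo] --> 0%E.
Proof.
move=> xi0 C0 SM.
have cvgC : (C * expR (- (xi / 2 * t)))%:E @[t --> within (times k) +oo] --> (C * 0)%:E.
  apply: cvg_EFin; first by near=> t.
  apply: cvg_within_filter.
  apply: cvgMl_tmp.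
  apply: (cvg_comp (fun t => xi / 2 * t) (fun y => expR (- y)) _ (@cvgr_expR R)).
  by apply: gt0_cvgMry; [rewrite divr_gt0|exact: cvg_id].
rewrite mulr0 in cvgC; apply: squeeze_cvge (cvg_cst 0%E) cvgC.
exists t0; split; first exact: num_real.
move=> t /ltW t0t kt; apply/andP; split.
  by rewrite mule_ge0 ?lee_fin ?expR_ge0 // /semidist le_max lexx.
have := within_nbhd_semidist (mulr_ge0 C0 (expR_ge0 _)) (SM t kt t0t).
move=> /(lee_wpmul2l (_ : 0 <= (expR (xi / 2 * t))%:E)%E) H.
apply: le_trans (H _) _; first by rewrite lee_fin expR_ge0.
rewrite -EFinM lee_fin mulrCA -expRD (_ : _ + _ = - (xi / 2 * t)) //; lra.
Unshelve. all: by end_near. Qed.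

(** Both directions of the theorem are instances, with [sigma] and [tau] equal to [T] and [T / N] in
    either order. The construction for [S tau] controls the multiples of [tau]; a general time [t]
    is split into [n * tau] and a remainder long enough to bring [G] into [B0]. *)
Lemma discrete_exp_attractor_any_time sigma tau M0 :
  semigroup k S -> asymptotically_closed k S -> 0 < tau -> times k tau ->
  discrete_exp_attractor k S sigma M0 ->
  exists M, discrete_exp_attractor k S tau M.
Proof.
move=> sS closedS tau0 ktau [M0_neq0 cM0 _ dimM0 [xi xi0 attrM0]].
(* With this [rho], the radius [rho ^+ n] is the attraction bound at time [n * tau]. *)
pose rho := expR (- (xi * tau)).
have rhoX n : rho ^+ n = expR (- (xi * (n%:R * tau))).
  by rewrite /rho -expRM_natl mulrN mulrCA.
have rho01 : 0 < rho < 1.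
  by rewrite expR_gt0 /= expR_lt1 oppr_lt0 mulr_gt0.
have [_ SD] := sS.
have [K [p [K0 M0c]]] := fractal_dim_covered rho01 M0_neq0 dimM0.
pose B0 := within_nbhd 1 M0.
have bB0 : metric_bounded B0.
  exact/metric_bounded_within_nbhd/(covered_bounded (M0c p (leqnn p))).
have [t0 t00 B0M0] := attracted_within_nbhd (attrM0 _ bB0).
have time_large s : exists n, forall m, (n <= m)%N -> s <= m%:R * tau.
  exists (Num.truncn (s / tau)).+1 => m nm.
  rewrite -ler_pdivrMr // (le_trans (ltW (truncnS_gt _))) // ler_nat //.
have [q qP] := time_large t0.
(* The coverings hold from [p] on, the attraction of [B0] from [q] on. *)
pose n0 := maxn p q.
have [||||M [M_neq0 cM SM Mc MB]] :=
    @discrete_attractor _ _ (S tau) M0 B0 rho K n0 rho01 K0 cM0.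
- by have [y My] := M0_neq0; exists y, y => //; exact: ballxx.
- by move=> n /(leq_trans (leq_maxl p q)); exact: M0c.
- move=> n /(leq_trans (leq_maxr p q)) /qP t0n _ [b Bb <-].
  rewrite semigroup_iter // rhoX; apply: B0M0 => //; first exact: timesMn.
- move=> n_ x_ x y n_k xB Sx Sy.
  apply: (closedS tau (fun k => (n_ k)%:R * tau) x_) => //.
  + by move=> j; exact: timesMn.
  + apply/cvgryPge => s; have [n nP] := time_large s; exists n => // j /= nj.
    by apply: nP; exact: leq_trans (n_k j).
  + have [r rP] := bB0; exists r => _ _ [i _ <-] [j _ <-]; exact: rP.
  + by under eq_fun do rewrite -semigroup_iter //.
  + apply: cvg_trans Sy; apply: near_eq_cvg; near=> j.
    by rewrite semigroup_iter // -natr1 mulrDl mul1r addrC.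
exists M; split => //.
  by apply: (covered_fractal_dim rho01 _ _ Mc) => //; rewrite muln_gt0.
exists (xi / 2) => [|G /attrM0/attracted_within_nbhd [t1 t10 GM0]].
  by rewrite divr_gt0.
have [w wP] := time_large t1.
pose s1 := w%:R * tau; have ks1 : times k s1 by exact: timesMn.
have SG s : times k s -> s1 <= s -> S s @` G `<=` B0.
  move=> ks s1s x /GM0 [||y My yx] //; first exact: le_trans (wP w (leqnn w)) s1s.
  exists y => //; apply: le_ball yx.
  by rewrite -[leRHS]expR0 ler_expR oppr_le0 mulr_ge0 ?(ltW xi0) // (times_ge0 ks).
(* With [n] the integer part of [(t - s1) / tau], the remainder [t - n * tau] lies between [s1] and
   [s1 + tau]: the lower bound brings [G] into [B0], the upper one costs the factor
   [expR (xi * (s1 + tau))]. The 4 is that of the net radius, and [t >= s1 + n0 * tau] gives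
   [n >= n0]. *)
apply: (@within_nbhd_attracted xi (4 * expR (xi * (s1 + tau)))
    (s1 + n0%:R * tau) G M xi0).
  by rewrite mulr_ge0 // expR_ge0.
move=> t kt s1t.
have d0 : 0 <= (t - s1) / tau.
  rewrite divr_ge0 ?(ltW tau0) // subr_ge0 (le_trans _ s1t) // lerDl.
  by rewrite mulr_ge0 // ltW.
have /andP[] := truncn_itv d0; set n := Num.truncn _ => nt tn.
rewrite ler_pdivlMr // in nt; rewrite ltr_pdivrMr // in tn.
have n0n : (n0 <= n)%N.
  by rewrite truncn_ge_nat // ler_pdivlMr // lerBrDl.
have kn : times k (n%:R * tau) by exact: timesMn.
have knt : times k (t - n%:R * tau).
  apply: timesB => //; have := times_ge0 ks1; lra.
have s1n : s1 <= t - n%:R * tau by lra.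
move=> _ [g Gg <-].
have [|y My yx] := MB n n0n (S t g).
  exists (S (t - n%:R * tau) g); first by apply: (SG _ knt s1n); exists g.
  by rewrite semigroup_iter // SD // addrC subrK.
exists y => //; apply: le_ball yx; rewrite rhoX -mulrA ler_wpM2l // -expRD ler_expR.
rewrite -subr_ge0 (_ : _ - _ = xi * (s1 + tau - t + n%:R * tau)); last by lra.
rewrite mulr_ge0 //; first exact: ltW.
by move: tn; rewrite -natr1 mulrDl mul1r; lra.
Unshelve. all: by end_near. Qed.

End ExponentialAttractors.

Theorem theorem2p10 (R : realType) (V : metricType R) (k : time_kind)
    (S : R -> V -> V) (T : R) (N : nat)
    (hV : complete_space V)
    (hS : semigroup k S)
    (hclosed : asymptotically_closed k S)
    (hT : 0 < T)
    (hN : (0 < N)%N)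
    (hTk : times k T)
    (hTNk : times k (T / N%:R)) :
  (exists M0 : set V, discrete_exp_attractor k S T M0) <->
  (exists M0' : set V, discrete_exp_attractor k S (T / N%:R) M0').
Proof.
by split => -[M attrM]; apply: discrete_exp_attractor_any_time attrM => //;
  rewrite divr_gt0 // ltr0n.
Qed.
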